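(* The Equality Shortest Path problem is undecidable.
   Context: A multidimensional shortest path game consists of a finite arena with vertex set $V$, edges $E\subseteq V\times V$ (each vertex has a successor), two players Eve and Adam owning a partition $V_E\uplus V_A$ of $V$, $t$ weight functions $w_i:E\to\mathbb{Z}$, and a single target set $T\subseteq V$. For a play $\pi=\pi_0\pi_1\dots$, $\mathrm{cost}(\pi)=(+\infty,\dots,+\infty)$ if $\pi$ never visits $T$, and otherwise $\mathrm{cost}(\pi)=(\mathrm{cost}_1(\pi),\dots,\mathrm{cost}_t(\pi))$ with $\mathrm{cost}_i(\pi)=\sum_{k=1}^{\ell}w_i((\pi_{k-1},\pi_k))$ where $\ell$ is the least index with $\pi_\ell\in T$. The Equality Shortest Path problem asks, given such a game, an initial vertex $v_0$ and a threshold $\bar c\in\mathbb{Z}^t$, whether Eve has a strategy $\sigma_E$ such that for every strategy $\sigma_A$ of Adam, the outcome play from $v_0$ satisfies $\mathrm{cost}(\mathrm{out}(\sigma_E,\sigma_A))=\bar c$. *)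

(* Defs.v *)
From HB Require Import structures.
From mathcomp Require Import all_boot all_order all_algebra.
From Stdlib Require Import ClassicalEpsilon.
Set Implicit Arguments. Unset Strict Implicit. Unset Printing Implicit Defensive.
Import GRing.Theory Num.Theory.

Inductive recf : Type :=
  | RZero : recf
  | RSucc : recf
  | RProj : nat -> recf
  | RComp : recf -> seq recf -> recf
  | RPrim : recf -> recf -> recf
  | RMu   : recf -> recf.

Inductive reval : recf -> seq nat -> nat -> Prop :=
  | ev_zero v : reval RZero v 0
  | ev_succ x v : reval RSucc (x :: v) x.+1
  | ev_proj i v : i < size v -> reval (RProj i) v (nth 0 v i)
  | ev_comp f gs v ys y :
      revals gs v ys -> reval f ys y -> reval (RComp f gs) v y
  | ev_prim0 f g v y : reval f v y -> reval (RPrim f g) (0 :: v) y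
  | ev_primS f g n v z y :
      reval (RPrim f g) (n :: v) z -> reval g (n :: z :: v) y ->
      reval (RPrim f g) (n.+1 :: v) y
  | ev_mu f v n :
      reval f (n :: v) 0 ->
      (forall m, m < n -> exists k, reval f (m :: v) k.+1) ->
      reval (RMu f) v n
with revals : seq recf -> seq nat -> seq nat -> Prop :=
  | evs_nil v : revals [::] v [::]
  | evs_cons g gs v y ys :
      reval g v y -> revals gs v ys -> revals (g :: gs) v (y :: ys).

(* A predicate on a countable type is decidable when some recursive function
   computes its characteristic function on the (standard, computable)
   natural-number codes [pickle x] of the elements. *)
Definition decidable_pred (T : countType) (P : T -> Prop) : Prop :=
  exists f : recf, forall x : T,
    (P x -> reval f [:: pickle x] 1) /\ (~ P x -> reval f [:: pickle x] 0).

(* Vertices are 0, ..., nV-1.  [owner]: true = Eve, false = Adam.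
   [edges]: list of (source, target, weight vector of length [dim]).
   [target]: the target set T. *)
Record game := Game {
  nV : nat;
  owner : seq bool;
  edges : seq (nat * nat * seq int);
  dim : nat;
  target : seq nat }.

Definition game_tuple (g : game) :=
  (nV g, owner g, edges g, dim g, target g).
Definition tuple_game (x : nat * seq bool * seq (nat * nat * seq int) * nat * seq nat) :=
  let: (a, b, c, d, e) := x in Game a b c d e.
Lemma game_tupleK : cancel game_tuple tuple_game. Proof. by case. Qed.
HB.instance Definition _ := Countable.copy game (can_type game_tupleK).

Section Game.
Variable g : game.

Definition is_eve (u : nat) : bool := nth false (owner g) u.
Definition is_edge_of (u v : nat) (e : nat * nat * seq int) : bool :=
  (e.1.1 == u) && (e.1.2 == v).
Definition is_edge (u v : nat) : bool := has (is_edge_of u v) (edges g).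
Definition in_target (u : nat) : bool := u \in target g.
Definition weight (i u v : nat) : int :=
  nth 0%R (nth (0, 0, [::]) (edges g) (find (is_edge_of u v) (edges g))).2 i.

Definition wf_game : Prop :=
  [/\ size (owner g) = nV g,
      all (fun e : nat * nat * seq int =>
             [&& e.1.1 < nV g, e.1.2 < nV g & size e.2 == dim g]) (edges g),
      uniq [seq e.1 | e <- edges g],
      (forall u, u < nV g -> exists2 v, v < nV g & is_edge u v)
    & all (fun u => u < nV g) (target g)].

(* Strategies map finite histories (ending in the current vertex) to a
   successor. *)
Definition strategy := seq nat -> nat.
Definition eve_strategy (s : strategy) : Prop :=
  forall (p : seq nat) (u : nat), u < nV g -> is_eve u ->
    is_edge u (s (rcons p u)).
Definition adam_strategy (s : strategy) : Prop :=
  forall (p : seq nat) (u : nat), u < nV g -> ~~ is_eve u ->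
    is_edge u (s (rcons p u)).

Fixpoint hist (sE sA : strategy) (v0 : nat) (k : nat) : seq nat :=
  match k with
  | 0 => [:: v0]
  | k'.+1 => let h := hist sE sA v0 k' in
             rcons h (if is_eve (last v0 h) then sE h else sA h)
  end.
Definition outcome (sE sA : strategy) (v0 : nat) : nat -> nat :=
  fun k => last v0 (hist sE sA v0 k).

Definition first_visit (pi : nat -> nat) : option nat :=
  match excluded_middle_informative (exists l, in_target (pi l)) with
  | left H => Some (ex_minn H)
  | right _ => None
  end.

(* cost(pi) in (Z u {+oo})^t, with None standing for +oo. *)
Definition cost (pi : nat -> nat) : seq (option int) :=
  match first_visit pi with
  | None => nseq (dim g) None
  | Some l => [seq Some (\sum_(k < l) weight i (pi k) (pi k.+1))%R
              | i <- iota 0 (dim g)]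
  end.

End Game.

(* An instance of the Equality Shortest Path problem:
   a game, an initial vertex v0 and a threshold c in Z^t. *)
Definition esp_instance := (game * nat * seq int)%type.

Definition wf_instance (x : esp_instance) : Prop :=
  let: (g, v0, c) := x in
  [/\ wf_game g, v0 < nV g & size c = dim g].

Definition ESP (x : esp_instance) : Prop :=
  let: (g, v0, c) := x in
  wf_instance x /\
  exists sE : strategy, eve_strategy g sE /\
    forall sA : strategy, adam_strategy g sA ->
      cost g (outcome g sE sA v0) = [seq Some ci | ci <- c].

(* Main.v *)
Require Import Defs.
From mathcomp Require Import all_boot all_order all_algebra.
From HB Require Import structures.
From mathcomp Require Import zify.
From Stdlib Require Import Classical ClassicalEpsilon FunctionalExtensionality.
From Stdlib Require Cantor.
(* [dim] would otherwise denote the dimension of a vector space. *)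
Import Defs.
Set Implicit Arguments. Unset Strict Implicit. Unset Printing Implicit Defensive.
Import GRing.Theory Num.Theory.

(* A system of Horn clauses over the naturals whose atoms are x = y + m, x = m
   and recursive calls can be played as a shortest path game: Eve guesses the
   values of the registers and the clause to use, Adam picks the atom to be
   verified, and an arithmetic atom is verified by letting Eve pay what remains
   of the threshold with self-loops along which it is an invariant.  A fixed
   system defines the evaluation relation of recursive functions on their
   codes, so for one fixed game the threshold (n, 0, ..., 0), where n is the
   code of f, is won by Eve if and only if f returns 0 on its own code.  A
   recursive decision procedure composed with n |-> (the code of this instance)
   would be a function f contradicting this equivalence on its own code. *)

(** * Recursive functions *)

Definition computable1 (F : nat -> nat) : Prop :=
  exists f : recf, forall n, reval f [:: n] (F n).

Lemma computable1_comp F G :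
  computable1 F -> computable1 G -> computable1 (fun n => F (G n)).
Proof.
move=> [f Hf] [g Hg]; exists (RComp f [:: g]) => n.
exact: ev_comp (evs_cons (Hg n) (evs_nil _)) (Hf _).
Qed.

Lemma computable1_id : computable1 id.
Proof. by exists (RProj 0) => n; exact: (@ev_proj 0 [:: n]). Qed.

Lemma computable1_succ : computable1 succn.
Proof. by exists RSucc => n; exact: ev_succ. Qed.

Lemma reval_const a : exists f : recf, forall v, reval f v a.
Proof.
elim: a => [|a [f Hf]]; first by exists RZero; exact: ev_zero.
exists (RComp RSucc [:: f]) => v.
exact: ev_comp (evs_cons (Hf v) (evs_nil _)) (ev_succ _ _).
Qed.

Lemma computable1_iter a G : computable1 G -> computable1 (fun n => iter n G a).
Proof.
move=> [g Hg]; have [f Hf] := reval_const a.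
exists (RPrim f (RComp g [:: RProj 1])); elim=> [|n IHn] /=.
  exact: ev_prim0.
apply: ev_primS IHn _; apply: ev_comp (Hg _).
exact: evs_cons (@ev_proj 1 [:: n; _] isT) (evs_nil _).
Qed.

Lemma computable1_addr a : computable1 (addn^~ a).
Proof.
have [f Hf] := computable1_iter a computable1_succ.
exists f => n; have := Hf n; rewrite (_ : iter n succn a = n + a) //.
by elim: n {Hf} => //= n ->.
Qed.

Lemma computable1_mulr a : computable1 (muln^~ a).
Proof.
have [f Hf] := computable1_iter 0 (computable1_addr a).
exists f => n; have := Hf n; rewrite (_ : iter n _ 0 = n * a) //.
by elim: n {Hf} => //= n ->; rewrite mulSn addnC.
Qed.

Lemma computable1_exp2 : computable1 (expn 2).
Proof.
have [f Hf] := computable1_iter 1 (computable1_mulr 2).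
exists f => n; have := Hf n; rewrite (_ : iter n _ 1 = 2 ^ n) //.
by elim: n {Hf} => //= n ->; rewrite expnSr.
Qed.

Lemma computable1_code_cons F a :
  computable1 F -> computable1 (fun n => CodeSeq.code (F n :: a)).
Proof.
move=> HF; apply: (computable1_comp (computable1_mulr _)).
exact: (computable1_comp computable1_exp2).
Qed.

Lemma computable1_code_pair F a :
  computable1 F -> computable1 (fun n => CodeSeq.code [:: a; F n]).
Proof.
move=> HF.
have [f Hf] : computable1 (fun n => ((2 ^ F n) * 2).+1 * 2 ^ a).
  apply: (computable1_comp (computable1_mulr _)).
  apply: (computable1_comp computable1_succ).
  apply: (computable1_comp (computable1_mulr _)).
  exact: (computable1_comp computable1_exp2).
exists f => n; have := Hf n.
by rewrite /CodeSeq.code /= muln1 muln2 mulnC.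
Qed.

(** With the game fixed, only one entry varies. Pairs and sequences are pickled by [CodeSeq.code],
    where prefixing [n] to a list of code [c] gives [2 ^ n * (2 * c + 1)]; the code of the instance
    is thus a composition of exponentials and affine maps. *)
Lemma computable1_pickle_instance (g : game) (v0 : nat) (s : seq int) :
  computable1 (fun n => pickle (g, v0, Posz n :: s)).
Proof.
apply: (@computable1_code_pair (fun n => pickle (Posz n :: s)) (pickle (g, v0))).
apply: (@computable1_code_cons (fun n => pickle (Posz n)) (map pickle s)).
(* An integer is pickled through a sum type, a sum as a pair of options, and an option as a list of
   length at most one. *)
apply: (@computable1_code_cons (fun n => CodeSeq.code [:: n]) [:: pickle (@None nat)]).
exact: (@computable1_code_cons id [::] computable1_id).
Qed.

(** * Induction, inversion and determinism for the evaluation relation *)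

Fixpoint all_prop (T : Type) (P : T -> Prop) (s : seq T) : Prop :=
  if s is x :: s' then P x /\ all_prop P s' else True.

(** The generated principle has no hypothesis for the functions in the list of [RComp]; the nested
    fixpoint supplies one through [all_prop]. *)
Lemma recf_nested_ind (P : recf -> Prop) :
  P RZero -> P RSucc -> (forall i, P (RProj i)) ->
  (forall f gs, P f -> all_prop P gs -> P (RComp f gs)) ->
  (forall f g, P f -> P g -> P (RPrim f g)) ->
  (forall f, P f -> P (RMu f)) ->
  forall f, P f.
Proof.
move=> P0 PS Pproj Pcomp Pprim Pmu; fix IH 1 => -[||i|f gs|f g|f].
- exact: P0.
- exact: PS.
- exact: Pproj.
- by apply: Pcomp; [exact: IH | elim: gs => [|g gs IHgs]; split => //; exact: IH].
- by apply: Pprim; exact: IH.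
- by apply: Pmu; exact: IH.
Qed.

Lemma reval_zeroE v y : reval RZero v y <-> y = 0.
Proof. by split=> [H | ->]; [inversion H | exact: ev_zero]. Qed.

Lemma reval_succE v y :
  reval RSucc v y <-> exists x w, v = x :: w /\ y = x.+1.
Proof.
split=> [H | [x [w [-> ->]]]]; last exact: ev_succ.
by inversion H; do 2 eexists.
Qed.

Lemma reval_projE i v y : reval (RProj i) v y <-> i < size v /\ nth 0 v i = y.
Proof. by split=> [H | [lt_i <-]]; [inversion H | exact: ev_proj]. Qed.

Lemma reval_compE f gs v y :
  reval (RComp f gs) v y <-> exists ys, revals gs v ys /\ reval f ys y.
Proof.
split=> [H | [ys [Hgs Hf]]]; last exact: ev_comp Hf.
by inversion H; subst; eexists; split; eauto.
Qed.

Lemma reval_prim0E f g v y : reval (RPrim f g) (0 :: v) y <-> reval f v y.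
Proof. by split=> [H | H]; [inversion H | exact: ev_prim0]. Qed.

Lemma reval_primSE f g n v y :
  reval (RPrim f g) (n.+1 :: v) y <->
  exists z, reval (RPrim f g) (n :: v) z /\ reval g (n :: z :: v) y.
Proof.
split=> [H | [z [Hz Hy]]]; last exact: ev_primS Hz Hy.
by inversion H; subst; eexists; split; eauto.
Qed.

Lemma reval_prim_nilE f g y : ~ reval (RPrim f g) [::] y.
Proof. by move=> H; inversion H. Qed.

Lemma reval_muE f v y :
  reval (RMu f) v y <->
  reval f (y :: v) 0 /\ (forall m, m < y -> exists k, reval f (m :: v) k.+1).
Proof. by split=> [H | [H0 HS]]; [inversion H | exact: ev_mu]. Qed.

Lemma revals_nilE v ys : revals [::] v ys <-> ys = [::].
Proof. by split=> [H | ->]; [inversion H | exact: evs_nil]. Qed.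

Lemma revals_consE g gs v ys :
  revals (g :: gs) v ys <->
  exists z zs, ys = z :: zs /\ (reval g v z /\ revals gs v zs).
Proof.
split=> [H | [z [zs [-> [Hz Hzs]]]]]; last exact: evs_cons.
by inversion H; subst; do 2 eexists.
Qed.

(** Determinism turns two values of the diagonal function into a contradiction. For [RMu], the
    smaller of two distinct results would give both zero and a positive value. *)
Lemma reval_inj f v y y' : reval f v y -> reval f v y' -> y = y'.
Proof.
elim/recf_nested_ind: f v y y' => [||i|f gs IHf IHgs|f g IHf IHg|f IHf] v y y'.
- by move=> /reval_zeroE-> /reval_zeroE->.
- by move=> /reval_succE[x [w [-> ->]]] /reval_succE[x' [w' [[-> _] ->]]].
- by move=> /reval_projE[_ <-] /reval_projE[_ <-].
- move=> /reval_compE[ys [Hys Hy]] /reval_compE[ys' [Hys' Hy']].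
  apply: IHf Hy _; suff -> : ys = ys' by [].
  elim: gs IHgs ys ys' Hys Hys' {Hy'} => [_|g gs IH /= [IHg IHgs]] ys ys'.
    by move=> /revals_nilE-> /revals_nilE->.
  move=> /revals_consE[z [zs [-> [Hz Hzs]]]].
  move=> /revals_consE[z' [zs' [-> [Hz' Hzs']]]].
  by rewrite (IHg _ _ _ Hz Hz') (IH IHgs _ _ Hzs Hzs').
- case: v => [/reval_prim_nilE //|n v].
  elim: n y y' => [|n IHn] y y'.
    by move=> /reval_prim0E Hy /reval_prim0E; exact: IHf.
  move=> /reval_primSE[z [Hz Hy]] /reval_primSE[z' [Hz']].
  by rewrite -(IHn _ _ Hz Hz'); exact: IHg.
- move=> /reval_muE[H0 HS] /reval_muE[H0' HS'].
  case: (ltngtP y y') => // lt_y.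
    by have [k /(IHf _ _ _ H0)] := HS' _ lt_y.
  by have [k /(IHf _ _ _ H0')] := HS _ lt_y.
Qed.

(** * Rank of a winning position *)

Lemma least_nat (P : nat -> Prop) :
  (exists n, P n) -> exists n, P n /\ forall m, P m -> n <= m.
Proof.
case=> n; elim/ltn_ind: n => n IHn Pn.
have [[m [lt_mn Pm]] | no_lt] := classic (exists m, m < n /\ P m); first exact: IHn Pm.
exists n; split=> // m Pm; rewrite leqNgt; apply/negP => lt_mn.
by apply: no_lt; exists m.
Qed.

Section Determinacy.
Variable g : game.
Hypothesis wf_g : wf_game g.

Definition advance (x : nat -> int) (u v : nat) : nat -> int :=
  fun i => (x i - weight g i u v)%R.

(* [x] is the part of the threshold that remains to be paid. *)
Fixpoint forces (n u : nat) (x : nat -> int) : Prop :=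
  if n is n'.+1 then
    if in_target g u then forall i, i < dim g -> x i = 0%R
    else if is_eve g u then
      exists v, is_edge g u v /\ forces n' v (advance x u v)
    else forall v, is_edge g u v -> forces n' v (advance x u v)
  else False.

Lemma forces_mono m n u x : m <= n -> forces m u x -> forces n u x.
Proof.
elim: m n u x => [//|m IHm] [//|n] u x; rewrite ltnS => le_mn /=.
case: ifP => // _; case: ifP => _.
  by case=> v [uv Hv]; exists v; split=> //; exact: IHm Hv.
by move=> H v uv; exact: IHm (H v uv).
Qed.

Lemma is_edge_lt u v : is_edge g u v -> u < nV g /\ v < nV g.
Proof.
case: wf_g => _ /allP edges_lt _ _ _ /hasP[e /edges_lt/and3P[]].
by move=> lt1 lt2 _ /andP[/eqP<- /eqP<-].
Qed.

(** The arena is finite, so the ranks of the successors have a common bound, built vertex by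
    vertex. *)
Lemma forces_all_edges u x :
  (forall v, is_edge g u v -> exists n, forces n v (advance x u v)) ->
  exists n, forall v, is_edge g u v -> forces n v (advance x u v).
Proof.
move=> H.
suff [n Hn] : exists n, forall v, v < nV g -> is_edge g u v ->
    forces n v (advance x u v).
  by exists n => v uv; apply: Hn => //; case/is_edge_lt: uv.
elim: (nV g) => [|N [n IHn]]; first by exists 0.
have [/H[m Hm] | not_uN] := boolP (is_edge g u N); last first.
  exists n => v; rewrite ltnS leq_eqVlt => /orP[/eqP-> uN|]; last exact: IHn.
  by rewrite uN in not_uN.
exists (maxn m n) => v; rewrite ltnS leq_eqVlt => /orP[/eqP-> _|lt_v uv].
  exact: forces_mono (leq_maxl m n) Hm.
exact: forces_mono (leq_maxr m n) (IHn _ lt_v uv).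
Qed.

(* A successor of least rank serves all [n] at once. *)
Lemma eve_choice u x : u < nV g -> is_eve g u -> exists v, is_edge g u v /\
  (~~ in_target g u ->
   forall n, forces n.+1 u x -> forces n v (advance x u v)).
Proof.
move=> lt_u eve_u; case: (wf_g) => _ _ _ /(_ u lt_u)[v _ uv] _.
have [tu | ntu] := boolP (in_target g u); first by exists v.
have [ex_n | no_n] := classic (exists n, forces n.+1 u x).
  have [n [Hn n_min]] := least_nat ex_n.
  have [w [uw Hw]] : exists w, is_edge g u w /\ forces n w (advance x u w).
    by move: Hn; rewrite /= (negbTE ntu) eve_u.
  by exists w; split=> // _ m /n_min le_nm; exact: forces_mono Hw.
by exists v; split=> // _ n Hn; case: no_n; exists n.
Qed.

(** Adam moves to a successor without rank if there is one. Otherwise the ranks of the successors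
    have a common bound, [u] has a rank itself, and any move will do. *)
Lemma adam_choice u x : u < nV g -> ~~ is_eve g u -> exists v, is_edge g u v /\
  (~~ in_target g u ->
   (exists n, forces n v (advance x u v)) -> exists n, forces n u x).
Proof.
move=> lt_u adam_u; case: (wf_g) => _ _ _ /(_ u lt_u)[v _ uv] _.
have [tu | ntu] := boolP (in_target g u); first by exists v.
have [[w [uw Hw]] | no_w] := classic (exists w, is_edge g u w /\
    ~ exists n, forces n w (advance x u w)).
  by exists w; split=> // _ /Hw.
exists v; split=> // _ _.
have [|n Hn] := @forces_all_edges u x.
  by move=> w uw; apply: NNPP => Hw; apply: no_w; exists w.
by exists n.+1; rewrite /= (negbTE ntu) (negbTE adam_u).
Qed.

Lemma forces_eq_dim n u x y : (forall i, i < dim g -> x i = y i) ->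
  forces n u x -> forces n u y.
Proof.
elim: n u x y => [//|n IHn] u x y eq_xy /=.
have adv v i : i < dim g -> advance x u v i = advance y u v i.
  by move=> lt_i; rewrite /advance eq_xy.
case: ifP => _; first by move=> H i lt_i; rewrite -eq_xy // H.
case: ifP => _; first by case=> v [uv Hv]; exists v; split=> //; exact: IHn (adv v) Hv.
by move=> H v uv; exact: IHn (adv v) (H v uv).
Qed.

Lemma forces_eq n u x y : x =1 y -> forces n u x -> forces n u y.
Proof. by move=> eq_xy; apply: forces_eq_dim => i _. Qed.

(** * Strategies read off the ranks *)

Variables (v0 : nat) (c : seq int).
Hypotheses (lt_v0 : v0 < nV g) (size_c : size c = dim g) (dim_gt0 : 0 < dim g).

Definition residual (pi : nat -> nat) (k : nat) : nat -> int :=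
  fun i => (nth 0 c i - \sum_(j < k) weight g i (pi j) (pi j.+1))%R.

Lemma residualS pi k :
  residual pi k.+1 =1 advance (residual pi k) (pi k) (pi k.+1).
Proof. by move=> i; rewrite /residual /advance big_ord_recr /= opprD addrA. Qed.

Lemma cost_eqP pi :
  cost g pi = [seq Some ci | ci <- c] <->
  exists l, [/\ in_target g (pi l), forall j, j < l -> ~~ in_target g (pi j)
              & forall i, i < dim g -> residual pi l i = 0%R].
Proof.
rewrite /cost /first_visit; case: excluded_middle_informative => [ex_l|no_l]; last first.
  split=> [|[l [tl _ _]]]; last by case: no_l; exists l.
  (* In dimension zero the infinite cost would be the empty list and equal the threshold; positive
     dimension separates them. *)
  by move: dim_gt0; rewrite -size_c; case: (c) => // a s; case: (dim g).
case: ex_minnP => l tl l_min; split=> [eq_c | [l' [tl' l'_min H]]].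
  exists l; split=> // [j lt_jl|i lt_i].
    by apply/negP => /l_min; rewrite leqNgt lt_jl.
  move/(congr1 (nth None ^~ i)): eq_c.
  rewrite (nth_map 0) ?size_iota // nth_iota // add0n (nth_map 0%R) ?size_c //.
  by case=> eq_i; rewrite /residual -eq_i subrr.
have -> : l = l'.
  apply/eqP; rewrite eqn_leq l_min // leqNgt; apply/negP => /l'_min.
  by rewrite tl.
apply: (@eq_from_nth _ None); first by rewrite !size_map size_iota size_c.
move=> i; rewrite size_map size_iota => lt_i.
rewrite (nth_map 0) ?size_iota // nth_iota // add0n (nth_map 0%R) ?size_c //.
by congr Some; apply/eqP; rewrite eq_sym -subr_eq0; apply/eqP; exact: H.
Qed.

Section Outcome.
Variables sE sA : strategy.
Let h := hist g sE sA v0.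
Let pi := outcome g sE sA v0.

Lemma size_hist k : size (h k) = k.+1.
Proof. by rewrite /h; elim: k => //= k IHk; rewrite size_rcons IHk. Qed.

Lemma nth_hist k j : j <= k -> nth 0 (h k) j = pi j.
Proof.
elim: k => [|k IHk]; first by rewrite leqn0 => /eqP->.
rewrite leq_eqVlt => /orP[/eqP->|lt_jk].
  by rewrite /pi /outcome -/(h k.+1) (last_nth 0) size_hist.
by rewrite /h /= nth_rcons -/(h k) size_hist lt_jk; exact: IHk.
Qed.

Lemma hist_rcons k : exists p, h k = rcons p (pi k).
Proof.
have : last v0 (h k) = pi k by [].
by case: (lastP (h k)) (size_hist k) => // p u _; rewrite last_rcons => ->; exists p.
Qed.

Lemma outcomeS k : pi k.+1 = if is_eve g (pi k) then sE (h k) else sA (h k).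
Proof. by rewrite /pi /outcome /= last_rcons. Qed.

Lemma outcome_edge : eve_strategy g sE -> adam_strategy g sA ->
  forall k, pi k < nV g /\ is_edge g (pi k) (pi k.+1).
Proof.
move=> HE HA; have step k : pi k < nV g -> is_edge g (pi k) (pi k.+1).
  rewrite outcomeS; have [p ->] := hist_rcons k => lt_k.
  by case: ifP => eve_k; [exact: HE | apply: HA; rewrite ?eve_k].
elim=> [|k [lt_k /is_edge_lt[_ lt_k1]]]; last by split=> //; exact: step.
by split; [exact: lt_v0 | exact: (step 0 lt_v0)].
Qed.

End Outcome.

(** The remaining threshold is a function of the history, so a strategy may consult it although it
    only sees vertices. *)
Definition hist_residual (h : seq nat) : nat -> int := residual (nth 0 h) (size h).-1.

Lemma hist_residualE sE sA k :
  hist_residual (hist g sE sA v0 k) =1 residual (outcome g sE sA v0) k.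
Proof.
move=> i; rewrite /hist_residual size_hist /residual /=; congr (_ - _)%R.
by apply: eq_bigr => j _; rewrite !nth_hist // ltnW.
Qed.

(** No rank is stored: [eve_choice] provides one move that works for every bound valid at the
    position. *)
Definition eve_forcing : strategy := fun h =>
  let u := last 0 h in let x := hist_residual h in
  epsilon (inhabits 0) (fun v => is_edge g u v /\
    (~~ in_target g u ->
     forall n, forces n.+1 u x -> forces n v (advance x u v))).

Definition adam_spoiling : strategy := fun h =>
  let u := last 0 h in let x := hist_residual h in
  epsilon (inhabits 0) (fun v => is_edge g u v /\
    (~~ in_target g u ->
     (exists n, forces n v (advance x u v)) -> exists n, forces n u x)).

Lemma eve_forcingP p u : u < nV g -> is_eve g u ->
  let h := rcons p u in let v := eve_forcing h in let x := hist_residual h in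
  is_edge g u v /\ (~~ in_target g u ->
    forall n, forces n.+1 u x -> forces n v (advance x u v)).
Proof.
move=> lt_u eve_u /=.
have := epsilon_spec (inhabits 0) _ (eve_choice (hist_residual (rcons p u)) lt_u eve_u).
by rewrite /eve_forcing last_rcons.
Qed.

Lemma adam_spoilingP p u : u < nV g -> ~~ is_eve g u ->
  let h := rcons p u in let v := adam_spoiling h in let x := hist_residual h in
  is_edge g u v /\ (~~ in_target g u ->
    (exists n, forces n v (advance x u v)) -> exists n, forces n u x).
Proof.
move=> lt_u adam_u /=.
have := epsilon_spec (inhabits 0) _ (adam_choice (hist_residual (rcons p u)) lt_u adam_u).
by rewrite /adam_spoiling last_rcons.
Qed.

Lemma forces_sound n sA : forces n v0 (nth 0%R c) -> adam_strategy g sA ->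
  cost g (outcome g eve_forcing sA v0) = [seq Some ci | ci <- c].
Proof.
move=> Hn HA; set pi := outcome _ _ _ _.
have HE : eve_strategy g eve_forcing.
  by move=> p u lt_u eve_u; case: (eve_forcingP p lt_u eve_u).
have edge k := outcome_edge HE HA k; rewrite -/pi in edge.
(* As long as the target is not met, [n - k] still bounds the rank after [k] moves. *)
have inv k : (forall j, j < k -> ~~ in_target g (pi j)) ->
    forces (n - k) (pi k) (residual pi k).
  elim: k => [_|k IHk nt].
    by rewrite subn0; apply: forces_eq Hn => i; rewrite /residual big_ord0 subr0.
  have {IHk} := IHk (fun j lt_j => nt j (ltnW lt_j)).
  rewrite subnS; case: (n - k) => [//|m] Hm /=.
  have ntk := nt k (ltnSn k); have [lt_k ek] := edge k.
  apply: (@forces_eq _ _ (advance (residual pi k) (pi k) (pi k.+1))).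
    by move=> i; rewrite residualS.
  have [eve_k | adam_k] := boolP (is_eve g (pi k)); last first.
    by move: Hm; rewrite /= (negbTE ntk) (negbTE adam_k); apply.
  have [p hp] := hist_rcons eve_forcing sA k; rewrite -/pi in hp.
  have res : hist_residual (rcons p (pi k)) =1 residual pi k.
    by move=> i; rewrite -hp hist_residualE.
  have [_ /(_ ntk m)] := eve_forcingP p lt_k eve_k; rewrite -hp => step.
  have -> : pi k.+1 = eve_forcing (hist g eve_forcing sA v0 k).
    by rewrite /pi outcomeS -/pi eve_k.
  have adv : advance (hist_residual (hist g eve_forcing sA v0 k)) (pi k)
      (eve_forcing (hist g eve_forcing sA v0 k)) =1
    advance (residual pi k) (pi k) (eve_forcing (hist g eve_forcing sA v0 k)).
    by move=> i; rewrite /advance hist_residualE.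
  apply: forces_eq adv _; apply: step; apply: forces_eq Hm => i.
  by rewrite hist_residualE.
apply/cost_eqP.
have [[k tk] | no_t] := classic (exists k, in_target g (pi k)); last first.
  (* A play avoiding the target would have rank bound 0 after [n] moves, and [forces 0] is false. *)
  have := inv n; rewrite subnn /=; case=> j _; apply/negP => tj.
  by apply: no_t; exists j.
have exk : exists k, in_target g (pi k) by exists k.
case: (ex_minnP exk) => l tl l_min; exists l.
have nt j : j < l -> ~~ in_target g (pi j).
  by move=> lt_jl; apply/negP => /l_min; rewrite leqNgt lt_jl.
split=> //; have := inv l nt; case: (n - l) => //= m.
by rewrite tl.
Qed.

Lemma forces_complete sE : eve_strategy g sE ->
  cost g (outcome g sE adam_spoiling v0) = [seq Some ci | ci <- c] ->
  exists n, forces n v0 (nth 0%R c).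
Proof.
move=> HE; set pi := outcome _ _ _ _.
have HA : adam_strategy g adam_spoiling.
  by move=> p u lt_u adam_u; case: (adam_spoilingP p lt_u adam_u).
have edge k := outcome_edge HE HA k; rewrite -/pi in edge.
case/cost_eqP=> l [tl nt res0].
have Hl : exists n, forces n (pi l) (residual pi l) by exists 1; rewrite /= tl.
(* Existence of a rank is carried back from the target to the start: [adam_spoiling] enters a ranked
   successor only from a ranked vertex. *)
suff down k : k <= l -> exists n, forces n (pi (l - k)) (residual pi (l - k)).
  have := down l (leqnn l); rewrite subnn => -[n Hn]; exists n.
  by apply: forces_eq Hn => i; rewrite /residual big_ord0 subr0.
elim: k => [|k IHk] lt_kl; first by rewrite subn0.
have [n] := IHk (ltnW lt_kl); set q := l - k.+1.
have -> : l - k = q.+1 by rewrite /q subnSK.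
have ntq : ~~ in_target g (pi q) by apply: nt; rewrite /q ltn_subrL (leq_trans _ lt_kl).
have [lt_q eq] := edge q => /(forces_eq (residualS pi q)) Hq.
have [eve_q | adam_q] := boolP (is_eve g (pi q)).
  by exists n.+1; rewrite /= (negbTE ntq) eve_q; exists (pi q.+1).
have [p hp] := hist_rcons sE adam_spoiling q; rewrite -/pi in hp.
have [_ /(_ ntq)] := adam_spoilingP p lt_q adam_q; rewrite -hp => step.
have pi_q1 : pi q.+1 = adam_spoiling (hist g sE adam_spoiling v0 q).
  by rewrite /pi outcomeS -/pi (negbTE adam_q).
case: step.
  exists n; rewrite -pi_q1; apply: forces_eq Hq => i.
  by rewrite /advance hist_residualE.
by move=> m Hm; exists m; apply: forces_eq Hm => i; rewrite hist_residualE.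
Qed.

Lemma ESP_forces : ESP (g, v0, c) <-> exists n, forces n v0 (nth 0%R c).
Proof.
split=> [[_ [sE [HE Hwin]]] | [n Hn]].
  apply: (forces_complete HE); apply: Hwin => p u lt_u adam_u.
  by case: (adam_spoilingP p lt_u adam_u).
split=> //; exists eve_forcing; split; last by move=> sA; exact: forces_sound Hn.
by move=> p u lt_u eve_u; case: (eve_forcingP p lt_u eve_u).
Qed.

End Determinacy.

(** * Games given by commands *)

Section GameOfRel.
Variables (N k : nat) (own : nat -> bool) (E : rel nat).
Variables (W : nat -> nat -> nat -> int) (t : nat).
Hypotheses (E_total : forall u, u < N -> exists2 v, v < N & E u v) (lt_t : t < N).

Let arcs := [seq uv <- allpairs pair (iota 0 N) (iota 0 N) | E uv.1 uv.2].

Definition game_of_rel : game :=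
  Game N (mkseq own N) [seq (uv, mkseq (W uv.1 uv.2) k) | uv <- arcs] k [:: t].

Lemma mem_arcs u v : ((u, v) \in arcs) = [&& u < N, v < N & E u v].
Proof.
rewrite mem_filter /=.
have -> : ((u, v) \in allpairs pair (iota 0 N) (iota 0 N)) = (u < N) && (v < N).
  apply/allpairsP/andP => [[[u' v'] /= [] + + [-> ->]] | [lt_u lt_v]].
    by rewrite !mem_iota.
  by exists (u, v); rewrite !mem_iota.
by rewrite andbC -andbA.
Qed.

Lemma game_of_rel_edge u v : is_edge game_of_rel u v = [&& u < N, v < N & E u v].
Proof.
rewrite -mem_arcs /is_edge /= has_map -has_pred1; apply: eq_has => -[u' v'].
by rewrite /is_edge_of /= -pair_eqE.
Qed.

Lemma game_of_rel_weight i u v : i < k -> is_edge game_of_rel u v ->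
  weight game_of_rel i u v = W u v i.
Proof.
move=> lt_i; rewrite game_of_rel_edge -mem_arcs => uv.
rewrite /weight /= find_map (@eq_find _ _ (pred1 (u, v))); last first.
  by move=> [u' v']; rewrite /is_edge_of /= -pair_eqE.
rewrite -/(index (u, v) arcs) (nth_map (0, 0)) ?index_mem // nth_index //=.
by rewrite nth_mkseq.
Qed.

Lemma game_of_rel_wf : wf_game game_of_rel.
Proof.
split=> /=; rewrite ?size_mkseq ?lt_t //.
- apply/allP => _ /mapP[[u v] + ->] /=.
  by rewrite mem_arcs => /and3P[-> -> _]; rewrite size_mkseq eqxx.
- rewrite -map_comp map_id filter_uniq //; apply: allpairs_uniq; rewrite ?iota_uniq //.
  by move=> [u v] [u' v'] _ _ [-> ->].
- move=> u lt_u; have [v lt_v uv] := E_total lt_u; exists v => //.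
  by rewrite game_of_rel_edge lt_u lt_v.
Qed.

End GameOfRel.

(** Commands are the vertices of the game. Adam owns [And], [Done] is the target, [Loop w a] carries
    a self-loop of weight [w], and [Call] closes the longer cycles. *)
Inductive cmd : Type :=
  | Done
  | Or of cmd & cmd
  | And of cmd & cmd
  | Loop of seq int & cmd
  | Add of seq int & cmd
  | Call of nat.

Lemma cmd_comparable : comparable cmd.
Proof. by move=> c c'; rewrite /decidable; decide equality; exact: eq_comparable. Qed.
HB.instance Definition _ := hasDecEq.Build cmd (compareP cmd_comparable).

Section Programs.
Variables (k : nat) (prog : seq cmd).

Definition body (p : nat) : cmd := nth Done prog p.

Definition owned_by_eve (c : cmd) : bool := if c is And _ _ then false else true.

Definition step (c c' : cmd) : bool :=
  match c with
  | Done => c' == Done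
  | Or a b | And a b => (c' == a) || (c' == b)
  | Loop w a => (c' == c) || (c' == a)
  | Add w a => c' == a
  | Call p => c' == body p
  end.

(** The empty list stands for the zero vector, through the default of [nth]. *)
Definition step_weight (c c' : cmd) : seq int :=
  match c with
  | Loop w a => if c' == c then w else [::]
  | Add w a => w
  | _ => [::]
  end.

Definition minus (x : nat -> int) (w : seq int) : nat -> int :=
  fun i => (x i - nth 0 w i)%R.

(** Inductive because Eve has to reach [Done] in finitely many moves: this is the least solution of
    the game equations. *)
Inductive wins : cmd -> (nat -> int) -> Prop :=
  | wins_done x : (forall i, i < k -> x i = 0%R) -> wins Done x
  | wins_orl a b x : wins a x -> wins (Or a b) x
  | wins_orr a b x : wins b x -> wins (Or a b) x
  | wins_and a b x : wins a x -> wins b x -> wins (And a b) x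
  | wins_exit w a x : wins a x -> wins (Loop w a) x
  | wins_loop w a x : wins (Loop w a) (minus x w) -> wins (Loop w a) x
  | wins_add w a x : wins a (minus x w) -> wins (Add w a) x
  | wins_call p x : wins (body p) x -> wins (Call p) x.

(** One unfolding of the program: calls are left to the interpretation [S], and a loop is summed up
    by its number of turns. *)
Fixpoint sem (S : nat -> (nat -> int) -> Prop) (c : cmd) (x : nat -> int) : Prop :=
  match c with
  | Done => forall i, i < k -> x i = 0%R
  | Or a b => sem S a x \/ sem S b x
  | And a b => sem S a x /\ sem S b x
  | Loop w a => exists n : nat, sem S a (fun i => x i - n%:Z * nth 0 w i)%R
  | Add w a => sem S a (minus x w)
  | Call p => S p x
  end.

(** Being least, [wins] is contained in every interpretation closed under the bodies. *)
Lemma wins_sem (S : nat -> (nat -> int) -> Prop) :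
  (forall p x, sem S (body p) x -> S p x) -> forall c x, wins c x -> sem S c x.
Proof.
move=> HS c x; elim=> {c x} /= [||||w a x _ Ha|w a x _ [n Hn]||]; auto.
  exists 0; move: Ha; congr sem; apply: functional_extensionality => i.
  by rewrite mul0r subr0.
exists n.+1; move: Hn; congr sem; apply: functional_extensionality => i.
by rewrite /minus -addn1 PoszD mulrDl mul1r opprD addrA addrAC.
Qed.

Lemma sem_wins c x : sem (fun p => wins (Call p)) c x -> wins c x.
Proof.
elim: c x => [|a IHa b IHb|a IHa b IHb|w a IHa|w a IHa|p] x //=.
- exact: wins_done.
- by case=> [/IHa|/IHb]; [exact: wins_orl | exact: wins_orr].
- by case=> /IHa Ha /IHb Hb; exact: wins_and.
- case=> n; elim: n x => [|n IHn] x H.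
    apply/wins_exit/IHa; move: H; congr sem; apply: functional_extensionality => i.
    by rewrite mul0r subr0.
  apply/wins_loop/IHn; move: H; congr sem; apply: functional_extensionality => i.
  by rewrite /minus -addn1 PoszD mulrDl mul1r opprD addrA addrAC.
- by move/IHa; exact: wins_add.
Qed.

Fixpoint subcmds (c : cmd) : seq cmd :=
  c :: match c with
       | Or a b | And a b => subcmds a ++ subcmds b
       | Loop _ a | Add _ a => subcmds a
       | _ => [::]
       end.

Variable main : cmd.

(** A finite set closed under [step]. [Done] belongs to it as the target and as the body of a call
    out of range. *)
Definition vertices : seq cmd :=
  undup (Done :: subcmds main ++ flatten (map subcmds prog)).

Lemma subcmds_refl c : c \in subcmds c.
Proof. by case: c => *; rewrite inE eqxx. Qed.

Lemma subcmds_step c d e : d \in subcmds c -> step d e ->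
  e \in subcmds c \/ e = Done \/ exists p, e = body p.
Proof.
elim: c => [|a IHa b IHb|a IHa b IHb|w a IHa|w a IHa|p] /=; rewrite inE.
- by move=> /eqP-> /eqP->; right; left.
- case/orP=> [/eqP-> /= /orP[]/eqP->|].
  + by left; rewrite inE mem_cat subcmds_refl orbT.
  + by left; rewrite inE mem_cat subcmds_refl !orbT.
  + rewrite mem_cat => /orP[/IHa H /H|/IHb H /H] []; auto => He;
      by left; rewrite inE mem_cat He !orbT.
- case/orP=> [/eqP-> /= /orP[]/eqP->|].
  + by left; rewrite inE mem_cat subcmds_refl orbT.
  + by left; rewrite inE mem_cat subcmds_refl !orbT.
  + rewrite mem_cat => /orP[/IHa H /H|/IHb H /H] []; auto => He;
      by left; rewrite inE mem_cat He !orbT.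
- case/orP=> [/eqP-> /= /orP[]/eqP->|].
  + by left; rewrite inE eqxx.
  + by left; rewrite inE subcmds_refl orbT.
  + by move=> /IHa H /H[]; auto => He; left; rewrite inE He orbT.
- case/orP=> [/eqP-> /= /eqP->|].
  + by left; rewrite inE subcmds_refl orbT.
  + by move=> /IHa H /H[]; auto => He; left; rewrite inE He orbT.
- by move=> /eqP-> /eqP->; right; right; exists p.
Qed.

Lemma vertices_done : Done \in vertices.
Proof. by rewrite mem_undup inE eqxx. Qed.

Lemma vertices_main : main \in vertices.
Proof. by rewrite mem_undup inE mem_cat subcmds_refl orbT. Qed.

Lemma vertices_body p : body p \in vertices.
Proof.
have [lt_p | ge_p] := ltnP p (size prog); last first.
  by rewrite /body nth_default //; exact: vertices_done.
rewrite mem_undup inE mem_cat; apply/orP; right; apply/orP; right.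
apply/flattenP; exists (subcmds (body p)); last exact: subcmds_refl.
by apply: map_f; exact: mem_nth.
Qed.

Lemma vertices_step c d : c \in vertices -> step c d -> d \in vertices.
Proof.
have sub a : (a = main \/ exists2 p, p < size prog & a = body p) ->
    forall b, b \in subcmds a -> b \in vertices.
  move=> Ha b Hb; rewrite mem_undup inE mem_cat; apply/orP; right; apply/orP.
  case: Ha => [<-|[p lt_p Ha]]; first by left.
  right; apply/flattenP; exists (subcmds a) => //; rewrite Ha.
  by apply: map_f; exact: mem_nth.
have closed a : (a = main \/ exists2 p, p < size prog & a = body p) ->
    c \in subcmds a -> step c d -> d \in vertices.
  move=> Ha Hc /(subcmds_step Hc)[/(sub _ Ha)//|[->|[p ->]]].
    exact: vertices_done.
  exact: vertices_body.
rewrite {1}mem_undup inE mem_cat => /or3P[/eqP-> /eqP->||].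
- exact: vertices_done.
- by apply: closed; left.
- case/flattenP=> _ /mapP[a /(nthP Done)[p lt_p <-] ->].
  by apply: closed; right; exists p.
Qed.

Lemma step_total c : c \in vertices -> exists2 d, d \in vertices & step c d.
Proof.
move=> Hc; suff [d cd] : exists d, step c d by exists d => //; exact: vertices_step cd.
case: c {Hc} => [|a b|a b|w a|w a|p].
- by exists Done; exact: eqxx.
- by exists a; rewrite /= eqxx.
- by exists a; rewrite /= eqxx.
- by exists a; rewrite /= eqxx orbT.
- by exists a; rewrite /= eqxx.
- by exists (body p); rewrite /= eqxx.
Qed.

Let vertex (u : nat) : cmd := nth Done vertices u.
Let number (c : cmd) : nat := index c vertices.

Definition cmd_game : game :=
  game_of_rel (size vertices) k (fun u => owned_by_eve (vertex u))
    (fun u v => step (vertex u) (vertex v))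
    (fun u v i => nth 0%R (step_weight (vertex u) (vertex v)) i) (number Done).

Lemma vertexK u : u < size vertices -> number (vertex u) = u.
Proof. by move=> lt_u; rewrite /number index_uniq // undup_uniq. Qed.

Lemma numberK c : c \in vertices -> vertex (number c) = c.
Proof. exact: nth_index. Qed.

Lemma cmd_game_wf : wf_game cmd_game.
Proof.
apply: game_of_rel_wf; last by rewrite index_mem vertices_done.
move=> u lt_u; have [d Hd cd] := step_total (mem_nth Done lt_u).
by exists (number d); rewrite ?index_mem // numberK.
Qed.

Lemma cmd_game_edge c d : c \in vertices -> d \in vertices ->
  is_edge cmd_game (number c) (number d) = step c d.
Proof.
by move=> Hc Hd; rewrite game_of_rel_edge !index_mem Hc Hd /= !numberK.
Qed.

Lemma cmd_game_advance c d x i : c \in vertices -> d \in vertices -> step c d ->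
  i < k -> advance cmd_game x (number c) (number d) i = minus x (step_weight c d) i.
Proof.
move=> Hc Hd cd lt_i; rewrite /advance /minus game_of_rel_weight //.
  by rewrite !numberK.
by rewrite -/cmd_game cmd_game_edge.
Qed.

Lemma cmd_game_target c : c \in vertices ->
  in_target cmd_game (number c) = (c == Done).
Proof.
move=> Hc; rewrite /in_target inE; apply/eqP/eqP => [|-> //].
by move/(congr1 vertex); rewrite !numberK ?vertices_done.
Qed.

Lemma cmd_game_eve c : c \in vertices ->
  is_eve cmd_game (number c) = owned_by_eve c.
Proof. by move=> Hc; rewrite /is_eve nth_mkseq ?index_mem // numberK. Qed.

(** Keeps the exit edge of a loop distinct from its self-loop, so that leaving costs zero. *)
Lemma Loop_neq w a : a == Loop w a = false.
Proof. by apply/eqP; elim: a w => // w a IHa w' [_ /IHa]. Qed.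

Lemma minus_nil x : minus x [::] = x.
Proof. by apply: functional_extensionality => i; rewrite /minus nth_nil subr0. Qed.

Lemma forces_wins n c x : c \in vertices ->
  forces cmd_game n (number c) x -> wins c x.
Proof.
elim: n c x => [//|n IHn] c x Hc /=; rewrite cmd_game_target // cmd_game_eve //.
have IH d : step c d ->
    forces cmd_game n (number d) (advance cmd_game x (number c) (number d)) ->
    wins d (minus x (step_weight c d)).
  move=> cd; have Hd := vertices_step Hc cd => H; apply: (IHn _ _ Hd).
  by apply: forces_eq_dim H => i; exact: cmd_game_advance.
have [-> H|ncD] := eqVneq c Done; first exact: wins_done.
case: ifP => eve_c; last first.
  move=> H; case: c Hc eve_c ncD H IH => //= a b Hc _ _ H IH.
  have sa : step (And a b) a by rewrite /= eqxx.
  have sb : step (And a b) b by rewrite /= eqxx orbT.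
  apply: wins_and; rewrite -[x]minus_nil; apply: IH; rewrite ?eqxx ?orbT //;
    apply: H; rewrite cmd_game_edge //; exact: vertices_step Hc _.
case=> v [cv]; have [_ lt_v] := is_edge_lt cmd_game_wf cv.
have Hd : vertex v \in vertices by exact: mem_nth.
move: cv; rewrite -(vertexK lt_v) cmd_game_edge // => /[dup] cd.
move: (vertex v) Hd cd => d Hd cd _ /(IH d cd) {IH}.
case: c Hc eve_c ncD cd => [|a b|a b|w a|w a|p] Hc //= _ ncD.
- by rewrite eqxx in ncD.
- by rewrite minus_nil => /orP[]/eqP->; [exact: wins_orl | exact: wins_orr].
- have [->|nd] := eqVneq d (Loop w a); first by move=> _; exact: wins_loop.
  by rewrite minus_nil => /eqP->; exact: wins_exit.
- by move=> /eqP->; exact: wins_add.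
- by rewrite minus_nil => /eqP->; exact: wins_call.
Qed.

Lemma wins_forces c x : wins c x -> c \in vertices ->
  exists n, forces cmd_game n (number c) x.
Proof.
(* Shared by all vertices of Eve other than the target: one move adds one to the rank. *)
have eve_step a d y : a \in vertices -> owned_by_eve a -> a <> Done -> step a d ->
    (d \in vertices ->
     exists n, forces cmd_game n (number d) (minus y (step_weight a d))) ->
    exists n, forces cmd_game n (number a) y.
  move=> Ha eve_a /eqP naD ad H; have Hd := vertices_step Ha ad.
  have [n Hn] := H Hd; exists n.+1 => /=.
  rewrite cmd_game_target // (negbTE naD) cmd_game_eve // eve_a; exists (number d).
  rewrite cmd_game_edge //; split=> //; apply: forces_eq_dim Hn => i lt_i.
  by rewrite cmd_game_advance.
elim=> {c x} [x Hx|a b x _ IH|a b x _ IH|a b x _ IHa _ IHb|w a x _ IH|w a x _ IH|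
  w a x _ IH|p x _ IH] Hc.
- by exists 1; rewrite /= cmd_game_target // eqxx.
- by apply: (eve_step _ a) => //=; rewrite ?eqxx // ?minus_nil.
- by apply: (eve_step _ b) => //=; rewrite ?eqxx ?orbT // ?minus_nil.
- have sa : step (And a b) a by rewrite /= eqxx.
  have sb : step (And a b) b by rewrite /= eqxx orbT.
  have [n Hn] := IHa (vertices_step Hc sa); have [m Hm] := IHb (vertices_step Hc sb).
  (* Adam picks the branch, so the bound has to serve both. *)
  exists (maxn n m).+1; rewrite /= cmd_game_target // cmd_game_eve //=; case: eqP => // _ v cv.
  have [_ lt_v] := is_edge_lt cmd_game_wf cv.
  have Hd : vertex v \in vertices by exact: mem_nth.
  move: cv; rewrite -(vertexK lt_v) cmd_game_edge // => cd.
  apply: (@forces_eq_dim _ _ _ x) => [i lt_i|].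
    by rewrite cmd_game_advance //= minus_nil.
  case/orP: cd => /eqP->.
    exact: forces_mono (leq_maxl n m) Hn.
  exact: forces_mono (leq_maxr n m) Hm.
- by apply: (eve_step _ a) => //=; rewrite ?eqxx ?orbT // Loop_neq ?minus_nil.
- by apply: (eve_step _ (Loop w a)) => //=; rewrite eqxx.
- by apply: (eve_step _ a) => //=; rewrite eqxx.
- by apply: (eve_step _ (body p)) => //=; rewrite ?eqxx // ?minus_nil.
Qed.

Lemma ESP_wins (c : seq int) : 0 < k -> size c = k ->
  ESP (cmd_game, number main, c) <-> wins main (nth 0%R c).
Proof.
move=> k_gt0 size_c; rewrite ESP_forces //; first last.
- by rewrite index_mem vertices_main.
- exact: cmd_game_wf.
split=> [[n /forces_wins]|/wins_forces]; apply; exact: vertices_main.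
Qed.

End Programs.

(** * Horn clauses *)

Definition upd (r : nat -> nat) (i n : nat) : nat -> nat :=
  fun j => if j == i then n else r j.

(** A pair [(i, j)] in [Invoke] assigns register [j] to [i]; registers not listed are passed on
    unchanged, so arguments may stay implicit. *)
Inductive clause : Type :=
  | Guess of nat & clause
  | Either of clause & clause
  | Both of clause & clause
  | IsSum of nat & nat & nat
  | IsConst of nat & nat
  | Invoke of nat & seq (nat * nat).

Fixpoint holds (T : nat -> (nat -> nat) -> Prop) (c : clause) (r : nat -> nat) : Prop :=
  match c with
  | Guess i a => exists n, holds T a (upd r i n)
  | Either a b => holds T a r \/ holds T b r
  | Both a b => holds T a r /\ holds T b r
  | IsSum i j m => r i = r j + m
  | IsConst i m => r i = m
  | Invoke p mv => T p (foldl (fun r ij => upd r ij.1 (r ij.2)) r mv)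
  end.

(** * Compilation of clauses into commands *)

Section Compilation.
Variable k : nat.

(** Registers must differ because a copy into [i] is guessed and then compared with [j], which the
    guess has to leave intact. *)
Fixpoint wf_clause (c : clause) : bool :=
  match c with
  | Guess i a => (i < k) && wf_clause a
  | Either a b | Both a b => wf_clause a && wf_clause b
  | IsSum i j m => [&& i < k, j < k & i != j]
  | IsConst i m => i < k
  | Invoke p mv => all (fun ij => [&& ij.1 < k, ij.2 < k & ij.1 != ij.2]) mv
  end.

Definition unit_vec (s : seq nat) (m : int) : seq int :=
  mkseq (fun j => if j \in s then m else 0%R) k.

(** Self-loops of weight one let Eve pay off any nonnegative amount in the coordinates of [s], and
    nothing elsewhere. *)
Definition drain (s : seq nat) : cmd := foldr (fun i => Loop (unit_vec [:: i] 1)) Done s.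

Definition others (s : seq nat) : seq nat := [seq l <- iota 0 k | l \notin s].

(** The joint loop preserves the difference of coordinates [i] and [j], so once [m] is paid both
    reach zero only if they differed by [m]. *)
Definition sum_cmd (i j m : nat) : cmd :=
  Add (unit_vec [:: i] m) (Loop (unit_vec [:: i; j] 1) (drain (others [:: i; j]))).

Definition const_cmd (i m : nat) : cmd :=
  Add (unit_vec [:: i] m) (drain (others [:: i])).

(* The first conjunct rejects a negative guess. *)
Definition guess_cmd (i : nat) (c : cmd) : cmd :=
  Loop (unit_vec [:: i] 1) (Loop (unit_vec [:: i] (-1)%R) (And (drain (iota 0 k)) c)).

Fixpoint compile (c : clause) : cmd :=
  match c with
  | Guess i a => guess_cmd i (compile a)
  | Either a b => Or (compile a) (compile b)
  | Both a b => And (compile a) (compile b)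
  | IsSum i j m => sum_cmd i j m
  | IsConst i m => const_cmd i m
  | Invoke p mv =>
      foldr (fun ij a => guess_cmd ij.1 (And (sum_cmd ij.1 ij.2 0) a)) (Call p) mv
  end.

Definition emb (r : nat -> nat) : nat -> int := fun i => Posz (r i).

Lemma emb_inj : injective emb.
Proof.
move=> r r' eq_r; apply: functional_extensionality => i.
by have := congr1 (fun x => x i) eq_r => -[].
Qed.

Lemma nth_unit_vec s m i :
  nth 0%R (unit_vec s m) i = if (i < k) && (i \in s) then m else 0%R.
Proof.
have [lt_i | ge_i] := ltnP i k; first by rewrite nth_mkseq.
by rewrite nth_default // size_mkseq.
Qed.

Section Semantics.
Variable S : nat -> (nat -> int) -> Prop.
Local Notation sem := (sem k S).

Lemma sem_drain s x : sem (drain s) x <->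
  forall i, i < k -> if i \in s then is_true (0 <= x i)%R else x i = 0%R.
Proof.
elim: s x => [|l s IHs] x //=; split=> [[n /IHs H] i lt_i|H].
  have := H i lt_i; rewrite nth_unit_vec lt_i !inE /=.
  by case: eqP => _ /=; case: ifP => _; lia.
(* When [l < k], that many turns bring coordinate [l], nonnegative by hypothesis, down to zero. *)
exists `|x l|%N; apply/IHs => i lt_i; have := H i lt_i.
rewrite nth_unit_vec lt_i !inE /=.
by case: eqP => [->|_] /=; case: ifP => _; lia.
Qed.

Lemma sem_others s x :
  sem (drain (others s)) x <->
  forall i, i < k -> if i \in s then x i = 0%R else (0 <= x i)%R.
Proof.
rewrite sem_drain; split=> H i lt_i; have := H i lt_i;
  rewrite mem_filter mem_iota lt_i andbT; by case: (i \in s).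
Qed.

Lemma sem_const i m r : i < k -> sem (const_cmd i m) (emb r) <-> r i = m.
Proof.
move=> lt_i; rewrite /= sem_others; split=> [/(_ i lt_i)|eq_m j lt_j].
  by rewrite inE eqxx /minus nth_unit_vec lt_i inE eqxx /= /emb; lia.
rewrite /minus nth_unit_vec lt_j !inE /= /emb.
by case: eqP => [->|_]; lia.
Qed.

Lemma sem_sum i j m r : i < k -> j < k -> i != j ->
  sem (sum_cmd i j m) (emb r) <-> r i = r j + m.
Proof.
move=> lt_i lt_j ne_ij; rewrite /= /minus; split=> [[n /sem_others H]|eq_ij].
  have := H i lt_i; have := H j lt_j.
  rewrite !nth_unit_vec lt_i lt_j !inE !eqxx eq_sym (negbTE ne_ij) /= /emb; lia.
exists (r j); apply/sem_others => l lt_l; rewrite !nth_unit_vec lt_l !inE /= /emb.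
have [->|_] := eqVneq l i; first by rewrite /=; lia.
by have [->|_] := eqVneq l j; rewrite /=; lia.
Qed.

Lemma sem_guess i c r : i < k ->
  sem (guess_cmd i c) (emb r) <-> exists n, sem c (emb (upd r i n)).
Proof.
move=> lt_i /=; split=> [[n1 [n2 [/sem_drain H]]]|[n Hn]].
  have H0 := H i lt_i.
  rewrite mem_iota lt_i /= in H0.
  set x := (X in sem c X) => Hc; exists `|x i|%N.
  move: Hc; congr sem; apply: functional_extensionality => j.
  rewrite /emb /upd; have [->|ne] := eqVneq j i; first by rewrite /x; lia.
  by rewrite /x !nth_unit_vec !inE (negbTE ne) !andbF /emb; lia.
(* The first loop empties register [i], the second fills it up to [n]. *)
exists (r i), n; set x := (fun j => _).
have -> : x = emb (upd r i n).
  apply: functional_extensionality => j.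
  rewrite /x /emb /upd !nth_unit_vec !inE.
  have [->|ne] := eqVneq j i; first by rewrite lt_i /=; lia.
  by rewrite !andbF; lia.
by split=> //; apply/sem_drain => j lt_j; rewrite mem_iota lt_j.
Qed.

(** It suffices that [S] and [T] agree on embedded vectors: guesses are checked for sign, so calls
    made from naturals happen at naturals. *)
Lemma sem_compile T : (forall p r, S p (emb r) <-> T p r) ->
  forall c r, wf_clause c -> sem (compile c) (emb r) <-> holds T c r.
Proof.
move=> ST; elim=> [i a IHa|a IHa b IHb|a IHa b IHb|i j m|i m|p mv] r.
- case/andP=> lt_i wf_a; rewrite [compile _]/= sem_guess //.
  by split=> -[n Hn]; exists n; apply/IHa.
- by case/andP=> wf_a wf_b /=; rewrite IHa // IHb.
- by case/andP=> wf_a wf_b /=; rewrite IHa // IHb.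
- by case/and3P=> lt_i lt_j ne; exact: sem_sum.
- exact: sem_const.
- elim: mv r => [|[i j] mv IHmv] r; first by move=> _; exact: ST.
  rewrite [wf_clause _]/= => /andP[/and3P[lt_i lt_j ne] /IHmv IH].
  rewrite [compile _]/= sem_guess //=.
  split=> [[n [+ Hn]]|H].
    rewrite -/(sem (sum_cmd i j 0) _) => /(sem_sum _ _ lt_i lt_j ne).
    rewrite /upd eqxx eq_sym (negbTE ne) addn0 => eq_n.
    by rewrite -eq_n; apply/IH.
  exists (r j); split; last exact/IH.
  apply/(sem_sum _ _ lt_i lt_j ne).
  by rewrite /upd eqxx eq_sym (negbTE ne) addn0.
Qed.

End Semantics.

(** * The least model of a Horn program *)

Section LeastModel.
Variable clauses : seq clause.
Hypothesis wf_clauses : all wf_clause clauses.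

Let prog := map compile clauses.

Definition derivable (p : nat) (r : nat -> nat) : Prop := wins k prog (Call p) (emb r).

Lemma derivableP c r : wf_clause c ->
  holds derivable c r -> wins k prog (compile c) (emb r).
Proof.
move=> wf_c Hc; apply: sem_wins; move: Hc.
by rewrite -(@sem_compile (fun p => wins k prog (Call p)) derivable).
Qed.

Lemma derivable_intro p r : p < size clauses ->
  holds derivable (nth (IsConst 0 0) clauses p) r -> derivable p r.
Proof.
move=> lt_p H; apply: wins_call; rewrite /body (nth_map (IsConst 0 0)) //.
by apply: derivableP H; move/(all_nthP (IsConst 0 0)): wf_clauses; apply.
Qed.

(** Fixpoint induction. A call out of range has body [Done] and may be won, so [T] has to hold there
    outright. *)
Lemma derivable_elim T :
  (forall p r, p < size clauses ->
     holds T (nth (IsConst 0 0) clauses p) r -> T p r) ->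
  (forall p r, size clauses <= p -> T p r) ->
  forall c r, wf_clause c -> wins k prog (compile c) (emb r) -> holds T c r.
Proof.
move=> T_in T_out c r wf_c.
(* This extends [T] to integer vectors, vacuously true off the image of [emb]. *)
pose S p x := forall r, x = emb r -> T p r.
have ST p r' : S p (emb r') <-> T p r'.
  by split=> [|H r'' /emb_inj <- //]; apply.
rewrite -(sem_compile ST) //; apply: wins_sem => {c r wf_c} p x H r eq_x.
have [lt_p | ] := ltnP p (size clauses); last exact: T_out.
apply: T_in => //; rewrite -(sem_compile ST).
  by rewrite -eq_x; move: H; rewrite /body (nth_map (IsConst 0 0)).
by move/(all_nthP (IsConst 0 0)): wf_clauses; apply.
Qed.

End LeastModel.
End Compilation.

(** * A Horn program evaluating recursive functions *)

(** Cantor's pairing, which [prS] and [prS0] compute by steps of one along the antidiagonals;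
    clauses can express this. *)
Definition pr (a b : nat) : nat := Cantor.to_nat (a, b).

Lemma pr_inj a b a' b' : pr a b = pr a' b' -> a = a' /\ b = b'.
Proof. by move/Cantor.to_nat_inj => [-> ->]. Qed.

Lemma prS a b : pr a b.+1 = (pr a.+1 b).+1.
Proof. by rewrite /pr /= !plusE !addnS. Qed.

Lemma prS0 a : pr a.+1 0 = (pr 0 a).+1.
Proof. by rewrite /pr /= !plusE addn0. Qed.

Definition codes (v : seq nat) : nat := foldr (fun a l => (pr a l).+1) 0 v.

Fixpoint code (f : recf) : nat :=
  match f with
  | RZero => pr 0 0
  | RSucc => pr 1 0
  | RProj i => pr 2 i
  | RComp f gs => pr 3 (pr (code f) (codes (map code gs)))
  | RPrim f g => pr 4 (pr (code f) (code g))
  | RMu f => pr 5 (code f)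
  end.

(* Predicates are numbered 0 (pairing), 1 (evaluation), 2 (evaluation of a list
   of functions), 3 (list lookup), 4 (positivity below a bound).  Pairing takes
   its arguments in registers 3, 4, 5, the others in registers 0, 1, 2;
   register 17 is local to [is_cons]. *)

Definition is_pair (a b c : nat) : clause := Invoke 0 [:: (3, a); (4, b); (5, c)].

Definition is_cons (a l m : nat) : clause :=
  Guess 17 (Both (IsSum m 17 1) (is_pair a l 17)).

Definition both (c : clause) (cs : seq clause) : clause := foldl Both c cs.

Definition guess (s : seq nat) (c : clause) : clause := foldr Guess c s.

(** The recursion of [prS] and [prS0]: registers 8 and 6 hold the preceding pair and 7 its code. *)
Definition pair_clause : clause :=
  Either (both (IsConst 3 0) [:: IsConst 4 0; IsConst 5 0])
    (guess [:: 6; 7; 8] (both (IsSum 5 7 1) [::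
      Either (Both (IsSum 4 6 1) (IsSum 8 3 1))
             (both (IsConst 4 0) [:: IsSum 3 6 1; IsConst 8 0]);
      is_pair 8 6 7])).

(** Registers 0, 1, 2 hold the codes of the function and of its arguments, and the result; 6 is the
    tag given by [code], 7 the payload. In primitive recursion, 12 is the predecessor of the
    recursion argument, 13 the recursive value, 14 and 16 the argument lists of the two
    evaluations. *)
Definition eval_clause : clause :=
  guess [:: 6; 7] (both (is_pair 6 7 0) [::
    Either (Both (IsConst 6 0) (IsConst 2 0))
   (Either (both (IsConst 6 1) [:: guess [:: 8; 9] (Both (is_cons 8 9 1) (IsSum 2 8 1))])
   (Either (both (IsConst 6 2) [:: Invoke 3 [:: (0, 7)]])
   (Either (both (IsConst 6 3) [:: guess [:: 8; 9; 10] (both (is_pair 8 9 7) [::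
              Invoke 2 [:: (0, 9); (2, 10)]; Invoke 1 [:: (0, 8); (1, 10)]])])
   (Either (both (IsConst 6 4) [:: guess [:: 8; 9; 10; 11] (both (is_pair 8 9 7) [::
              is_cons 10 11 1;
              Either (both (IsConst 10 0) [:: Invoke 1 [:: (0, 8); (1, 11)]])
                (guess [:: 12; 13; 14; 15; 16] (both (IsSum 10 12 1) [::
                   is_cons 12 11 14; Invoke 1 [:: (1, 14); (2, 13)];
                   is_cons 13 11 15; is_cons 12 15 16;
                   Invoke 1 [:: (0, 9); (1, 16)]]))])])
           (both (IsConst 6 5) [:: guess [:: 8; 9] (both (is_cons 2 1 8) [:: IsConst 9 0;
              Invoke 1 [:: (0, 7); (1, 8); (2, 9)]; Invoke 4 [:: (0, 7)]])])))))]).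

Definition evals_clause : clause :=
  Either (Both (IsConst 0 0) (IsConst 2 0))
    (guess [:: 6; 7; 8; 9] (both (is_cons 6 7 0) [:: is_cons 8 9 2;
       Invoke 1 [:: (0, 6); (2, 8)]; Invoke 2 [:: (0, 7); (2, 9)]])).

Definition lookup_clause : clause :=
  guess [:: 6; 7] (both (is_cons 6 7 1) [::
    Either (Both (IsConst 0 0) (IsSum 2 6 0))
      (Guess 8 (Both (IsSum 0 8 1) (Invoke 3 [:: (0, 8); (1, 7)])))]).

(** A bounded universal quantifier as a recursion on the bound in register 2; the value in register
    9 is positive, being the successor of register 8. *)
Definition positive_clause : clause :=
  Either (IsConst 2 0)
    (guess [:: 6; 7; 8; 9] (both (IsSum 2 6 1) [:: Invoke 4 [:: (2, 6)];
       is_cons 6 1 7; IsSum 9 8 1; Invoke 1 [:: (1, 7); (2, 9)]])).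

Definition universal : seq clause :=
  [:: pair_clause; eval_clause; evals_clause; lookup_clause; positive_clause].

(** For soundness only. The universal quantifiers start from given codes, so no number has to be
    decoded. Predicate 2 does assert that register 2 holds a code, as composition needs for its
    guessed intermediate list. *)
Definition spec (p : nat) (r : nat -> nat) : Prop :=
  match p with
  | 0 => r 5 = pr (r 3) (r 4)
  | 1 => forall f v, r 0 = code f -> r 1 = codes v -> reval f v (r 2)
  | 2 => forall gs v, r 0 = codes (map code gs) -> r 1 = codes v ->
         exists ys, r 2 = codes ys /\ revals gs v ys
  | 3 => forall v, r 1 = codes v -> r 0 < size v /\ nth 0 v (r 0) = r 2
  | 4 => forall f v, r 0 = code f -> r 1 = codes v ->
         forall m, m < r 2 -> exists y, reval f (m :: v) y.+1
  | _ => True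
  end.

Lemma codes_cons a l v : codes v = (pr a l).+1 -> exists w, v = a :: w /\ codes w = l.
Proof. by case: v => [//|x w] /= [] /pr_inj[-> <-]; exists w. Qed.

Lemma is_consP l a b : (exists n, l = n + 1 /\ n = pr a b) -> l = (pr a b).+1.
Proof. by case=> n [-> ->]; rewrite addn1. Qed.

Lemma spec_sound p r : p < size universal ->
  holds spec (nth (IsConst 0 0) universal p) r -> spec p r.
Proof.
case: p => [|[|[|[|[|//]]]]] _; rewrite /= /upd /=.
- case=> [[[-> ->] ->] // | [b [c [d [[-> H] ->]]]]]; rewrite addn1.
  by case: H => [[-> ->]|[[-> ->] ->]]; rewrite !addn1 ?prS ?prS0.
- case=> t [a [-> H]] f v eq_f eq_v; move: H.
  (* Injectivity of pairing fixes the tag, and only the alternative with this tag survives. *)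
  case: f eq_f => [||i|f gs|f g|f] /= /pr_inj[-> ->];
    do 5 ?[case=> [[? H]|]; first try by []]; try by case.
  + by rewrite H; exact: ev_zero.
  + move: H => [x [l [/is_consP + ->]]]; rewrite eq_v.
    by case/codes_cons=> w [-> _]; rewrite addn1; exact: ev_succ.
  + by have [lt_i <-] := H _ eq_v; exact: ev_proj.
  + move: H => [b [d [m [[/pr_inj[<- <-] Hgs] Hf]]]].
    have [ys [eq_m Hys]] := Hgs gs v erefl eq_v.
    exact: ev_comp Hys (Hf f ys erefl eq_m).
  + move: H => [b [d [n [l [[/pr_inj[<- <-] /is_consP +] H]]]]]; rewrite eq_v.
    case/codes_cons=> w [-> eq_w].
    case: H => [[-> H] | [n' [z [? [? [? [[[[[-> /is_consP->] Hz] /is_consP->] /is_consP->] H]]]]]]].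
      by apply/ev_prim0/H.
    rewrite !addn1 in Hz H *; apply: ev_primS.
      by apply: (Hz _ (n' :: w)); rewrite ?eq_f //= eq_w.
    by apply: H; rewrite //= eq_w.
  + case=> _ [? [? [[[/is_consP-> ->] H0] HS]]].
    by apply: ev_mu; [apply: H0; rewrite //= eq_v | exact: HS].
- case=> [[-> ->]|[a [b [y [l [[[/is_consP-> /is_consP->] Ha] Hb]]]]]] gs v.
    by case: gs => // _ _; exists [::]; split=> //; exact: evs_nil.
  case: gs => //= g gs [/pr_inj[eq_a eq_b]] eq_v.
  have [ys [eq_l Hys]] := Hb _ _ eq_b eq_v.
  by exists (y :: ys); rewrite /= eq_l; split=> //; exact: evs_cons (Ha _ _ eq_a eq_v) Hys.
- case=> a [l [/is_consP-> H]] v => /esym/codes_cons[w [-> eq_w]].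
  case: H => [[-> ->]|[i [-> /(_ w)]]]; first by rewrite addn0.
  by rewrite eq_w addn1 => /(_ erefl)[lt_i <-].
- case=> [->|[n [? [y [? [[[[-> IH] /is_consP->] ->] H]]]]]] // f v eq_f eq_v m.
  rewrite !addn1 ltnS leq_eqVlt in H * => /orP[/eqP->|]; last exact: IH.
  by exists y; apply: H; rewrite //= eq_v.
Qed.

Definition dims : nat := 18.

Lemma universal_wf : all (wf_clause dims) universal.
Proof. by []. Qed.

(** * Completeness of the Horn program *)

Local Notation derives := (derivable dims universal).
Local Notation derives_intro := (derivable_intro universal_wf).

(** By induction on the paired value in register 5, which drops by one in each call. *)
Lemma derives_pair r : r 5 = pr (r 3) (r 4) -> derives 0 r.
Proof.
move: {2}(r 5) (erefl (r 5)) => n; elim: n r => [|n IHn] r eq_n eq_r.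
  apply: derives_intro => //=; left; move: eq_r; rewrite eq_n.
  by case: (r 3) (r 4) => [|a] [|b] //; rewrite ?prS ?prS0.
apply: derives_intro => //; right; move: eq_r; rewrite eq_n.
case eq_b: (r 4) => [|b]; first case eq_a: (r 3) => [//|a].
  rewrite prS0 => -[eq_r]; exists a, n, 0; rewrite /= /upd /=; split.
    by split; [rewrite eq_n addn1 | right; rewrite eq_b eq_a addn1].
  by apply: IHn; rewrite /upd /=.
rewrite prS => -[eq_r]; exists b, n, (r 3).+1; rewrite /= /upd /=; split.
  by split; [rewrite eq_n addn1 | left; rewrite eq_b !addn1].
by apply: IHn; rewrite /upd /=.
Qed.

(** Shaped for the unfolded [is_cons], where register 5 carries the predecessor of [l]. *)
Lemma derives_cons l a b : l = (pr a b).+1 ->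
  forall r, r 5 = pr a b -> r 3 = a -> r 4 = b -> l = r 5 + 1 /\ derives 0 r.
Proof.
move=> -> r r5 r3 r4; split; first by rewrite r5 addn1.
by apply: derives_pair; rewrite r5 r3 r4.
Qed.

Lemma derives_lookup v i r : i < size v ->
  r 0 = i -> r 1 = codes v -> r 2 = nth 0 v i -> derives 3 r.
Proof.
elim: v i r => [//|a v IHv] i r lt_i r0 r1 r2; apply: derives_intro => //.
exists a, (codes v); split.
  by exists (pr a (codes v)); apply: (derives_cons r1).
case: i lt_i r0 r2 => [|i] lt_i r0 r2; [left | right].
  by split=> //; rewrite /= /upd /= r2 addn0.
exists i; split; first by rewrite /= /upd /= r0 addn1.
by apply: (IHv i).
Qed.

Definition eval_complete (f : recf) : Prop := forall v y r, reval f v y ->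
  r 0 = code f -> r 1 = codes v -> r 2 = y -> derives 1 r.

Lemma derives_evals gs : all_prop eval_complete gs ->
  forall v ys r, revals gs v ys ->
  r 0 = codes (map code gs) -> r 1 = codes v -> r 2 = codes ys -> derives 2 r.
Proof.
elim: gs => [_|g gs IHgs [IHg /IHgs {}IHgs]] v ys r.
  by move=> /revals_nilE-> r0 _ r2; apply: derives_intro => //; left.
move=> /revals_consE[y [zs [-> [Hy Hzs]]]] r0 r1 r2; apply: derives_intro => //; right.
exists (code g), (codes (map code gs)), y, (codes zs); split; first split; first split.
- by exists (pr (code g) (codes (map code gs))); apply: (derives_cons r0).
- by exists (pr y (codes zs)); apply: (derives_cons r2).
- exact: IHg Hy _ _ _.
- exact: IHgs Hzs _ _ _.
Qed.

Lemma derives_positive f v n r : eval_complete f ->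
  (forall m, m < n -> exists y, reval f (m :: v) y.+1) ->
  r 0 = code f -> r 1 = codes v -> r 2 = n -> derives 4 r.
Proof.
move=> IHf; elim: n r => [|n IHn] r Hlt r0 r1 r2; apply: derives_intro => //; first by left.
right; have [y Hy] := Hlt n (ltnSn n).
exists n, (codes (n :: v)), y, y.+1; split; first split; first split; first split.
- by rewrite /= /upd /= r2 addn1.
- by apply: IHn => // m lt_m; apply: Hlt; exact: ltnW.
- exists (pr n (codes v)); split; first by rewrite /= /upd /= addn1.
  by apply: derives_pair; rewrite /= /upd /= r1.
- by rewrite /= /upd /= addn1.
- exact: IHf Hy _ _ _.
Qed.

(** By induction on [f], the guessed registers receiving the parts of a given evaluation; primitive
    recursion takes an inner induction on its first argument. *)
Lemma derives_eval f : eval_complete f.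
Proof.
elim/recf_nested_ind: f => [||i|f gs IHf IHgs|f g IHf IHg|f IHf] v y r.
- move=> /reval_zeroE y0 r0 _ r2; apply: derives_intro => //; exists 0, (pr 0 0).
  split; first by apply: derives_pair; rewrite /= /upd /= r0.
  by left; split=> //; rewrite /= /upd /= r2.
- move=> /reval_succE[x [w [-> ->]]] r0 r1 r2; apply: derives_intro => //; exists 1, 0.
  split; first by apply: derives_pair; rewrite /= /upd /= r0.
  right; left; split=> //; exists x, (codes w); split.
    by exists (pr x (codes w)); apply: (derives_cons r1).
  by rewrite /= /upd /= r2 addn1.
- move=> /reval_projE[lt_i eq_y] r0 r1 r2; apply: derives_intro => //; exists 2, i.
  split; first by apply: derives_pair; rewrite /= /upd /= r0.
  do 2 right; left; split=> //; apply: (derives_lookup lt_i) => //.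
  by rewrite /= /upd /= r2.
- move=> /reval_compE[ys [Hys Hy]] r0 r1 r2; apply: derives_intro => //.
  exists 3, (pr (code f) (codes (map code gs))).
  split; first by apply: derives_pair; rewrite /= /upd /= r0.
  do 3 right; left; split=> //; exists (code f), (codes (map code gs)), (codes ys).
  split; [split|].
  + exact: derives_pair.
  + exact: derives_evals IHgs _ _ _ Hys _ _ _.
  + exact: IHf Hy _ _ _.
- case: v => [/reval_prim_nilE //|n v].
  elim: n y r => [|n IHn] y r Hy r0 r1 r2; apply: derives_intro => //;
    exists 4, (pr (code f) (code g));
    (split; first by apply: derives_pair; rewrite /= /upd /= r0);
    do 4 right; left; split=> //.
    exists (code f), (code g), 0, (codes v); split; first split.
    + exact: derives_pair.
    + by exists (pr 0 (codes v)); apply: (derives_cons r1).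
    + by left; split=> //; move/reval_prim0E: Hy => Hy; exact: IHf Hy _ _ _.
  move/reval_primSE: Hy => [z [Hz Hy]].
  exists (code f), (code g), n.+1, (codes v); split; first split.
  + exact: derives_pair.
  + by exists (pr n.+1 (codes v)); apply: (derives_cons r1).
  + right; exists n, z, (codes (n :: v)), (codes (z :: v)), (codes (n :: z :: v)).
    split; first split; first split; first split; first split.
    * by rewrite /= /upd /= addn1.
    * by exists (pr n (codes v)); apply: (@derives_cons (codes (n :: v)) _ _ erefl).
    * exact: IHn Hz _ _ _.
    * by exists (pr z (codes v)); apply: (@derives_cons (codes (z :: v)) _ _ erefl).
    * by exists (pr n (codes (z :: v)));
        apply: (@derives_cons (codes (n :: z :: v)) _ _ erefl).
    * exact: IHg Hy _ _ _.
- move=> /reval_muE[H0 HS] r0 r1 r2; apply: derives_intro => //; exists 5, (code f).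
  split; first by apply: derives_pair; rewrite /= /upd /= r0.
  do 5 right; split=> //; exists (codes (y :: v)), 0; split; first split; first split.
  + exists (pr y (codes v)); split; first by rewrite /= /upd /= addn1.
    by apply: derives_pair; rewrite /= /upd /= r1 r2.
  + by [].
  + exact: IHf H0 _ _ _.
  + exact: derives_positive IHf HS _ _ _.
Qed.

(** * The diagonal argument *)

(** Started with all registers but 0 at zero: register 6 codes the empty list, so register 1 must
    code the one-element list of register 0, and register 2 asks for the result 0. *)
Definition start_clause : clause := Guess 1 (Both (is_cons 0 6 1) (Invoke 1 [::])).

Definition start_cmd : cmd := compile dims start_clause.

Definition universal_prog : seq cmd := map (compile dims) universal.

Definition self_eval_instance (n : nat) : esp_instance :=
  (cmd_game dims universal_prog start_cmd,
   index start_cmd (vertices universal_prog start_cmd),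
   Posz n :: nseq dims.-1 0%R).

Lemma start_clauseP f : let r := upd (fun _ => 0) 0 (code f) in
  wins dims universal_prog start_cmd (emb r) <-> reval f [:: code f] 0.
Proof.
move=> r; split=> [|Hf].
  (* Beyond the five predicates [spec] is [True], which settles calls out of range. *)
  move=> /(derivable_elim universal_wf spec_sound)[] // => [[|[|[|[|[|p]]]]] //|l].
  by case=> /is_consP eq_l eval_l; exact: (eval_l f [:: code f] erefl eq_l).
apply: (@derivableP dims universal start_clause r) => //; exists (codes [:: code f]); split.
  by exists (pr (code f) 0); apply: (@derives_cons (codes [:: code f]) _ _ erefl).
exact: derives_eval Hf _ _ _.
Qed.

Lemma ESP_self_eval f :
  ESP (self_eval_instance (code f)) <-> reval f [:: code f] 0.
Proof.
rewrite -start_clauseP /self_eval_instance ESP_wins ?size_nseq //.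
have -> // : nth 0%R (Posz (code f) :: nseq dims.-1 0%R) =
    emb (upd (fun _ => 0) 0 (code f)).
(* Past its end the threshold reads as 0, in agreement with the registers. *)
by apply: functional_extensionality => -[//|i];
  rewrite -[LHS]/(nth 0%R (nseq dims.-1 0%R) i) nth_nseq if_same.
Qed.

Theorem theorem14 : ~ decidable_pred ESP.
Proof.
case=> d Hd.
have [e He] := computable1_pickle_instance
  (cmd_game dims universal_prog start_cmd)
  (index start_cmd (vertices universal_prog start_cmd)) (nseq dims.-1 0%R).
(* [f] runs the supposed decision procedure on the instance built from its input; on its own code it
   thus decides whether it returns 0. *)
pose f := RComp d [:: e]; pose x := self_eval_instance (code f).
have eval_f y : reval d [:: pickle x] y -> reval f [:: code f] y.
  exact: ev_comp (evs_cons (He (code f)) (evs_nil _)).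
have [Hx | nHx] := classic (ESP x).
  (* If Eve wins, [f] returns both 1 and 0 on its code. *)
  have /eval_f f1 := (Hd x).1 Hx.
  by have := reval_inj f1 ((ESP_self_eval f).1 Hx).
(* If Eve does not win, [f] returns 0 on its code, which makes her win. *)
by apply: (nHx); apply/ESP_self_eval/eval_f; exact: (Hd x).2 nHx.
Qed.
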